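(* Let $\mathcal C$ be a category with a final object and fiber products, in which all fiber squares are independent and all morphisms are confined, and let $F^*$ be a contravariant functor on $\mathcal C$. Then the assignment $f\mapsto \delta\mathbb B^{coop}F^*(X\xrightarrow{f}Y)$ is a bivariant theory with the co-operational product, pushforward and pullback (i.e. with the restrictions of the operations of $\mathbb B^{coop}F^*$). Hence $\delta\mathbb B^{coop}F^*$ is a subtheory of the co-operational bivariant theory $\mathbb B^{coop}F^*$.
   Context: **Functor.** $F^*$ takes values in sets with extra structure including a zero element $0$ preserved by all pullbacks $f^*$ (e.g. graded abelian groups, or isomorphism classes of vector bundles). The maps below are just maps of sets, and gradings are ignored. **Cohomology operations.** A cohomology operation of $F^*$ is a natural self-transformation $\theta:F^*\to F^*$, i.e. a family of maps $\theta_X:F^*(X)\to F^*(X)$ with $f^*\circ\theta_Y=\theta_X\circ f^*$ for every $f:X\to Y$. Each $\theta_X$ is moreover assumed to send $0$ to $0$ (''zero-zero condition''). $coopF^*$ is the set of all such $\theta$. **Bivariant theory (set-valued).** This assigns to each morphism $f:X\to Y$ a set $\mathbb B(X\xrightarrow{f}Y)$, with operations: - product $\bullet:\mathbb B(X\xrightarrow{f}Y)\times\mathbb B(Y\xrightarrow{g}Z)\to\mathbb B(X\xrightarrow{g\circ f}Z)$; - pushforward $f_*:\mathbb B(X\xrightarrow{g\circ f}Z)\to\mathbb B(Y\xrightarrow{g}Z)$ for $X\xrightarrow{f}Y\xrightarrow{g}Z$; - pullback $g^*:\mathbb B(X\xrightarrow{f}Y)\to\mathbb B(X'\xrightarrow{f'}Y')$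 for each fiber square with $g:Y'\to Y$, $g':X'\to X$, $f':X'\to Y'$, $f\circ g'=g\circ f'$. The axioms are: - ($A_1$) $(\alpha\bullet\beta)\bullet\gamma=\alpha\bullet(\beta\bullet\gamma)$; - ($A_2$) $(g\circ f)_*=g_*\circ f_*$; - ($A_3$) $(g\circ h)^*=h^*\circ g^*$; - ($A_{12}$) $f_*(\alpha\bullet\beta)=f_*\alpha\bullet\beta$ for $X\xrightarrow{f}Y\xrightarrow{g}Z\xrightarrow{h}W$, $\alpha\in\mathbb B(X\xrightarrow{g\circ f}Z)$, $\beta\in\mathbb B(Z\xrightarrow{h}W)$; - ($A_{13}$) $h^*(\alpha\bullet\beta)=h'^*\alpha\bullet h^*\beta$ for two stacked fiber squares over $X\xrightarrow{f}Y\xrightarrow{g}Z$ with base $h:Z'\to Z$ and $h':Y'\to Y$ the pullback of $h$; - ($A_{23}$) $f'_*(h^*\alpha)=h^*(f_*\alpha)$ in the same stacked squares, $\alpha\in\mathbb B(X\xrightarrow{g\circ f}Z)$; - ($A_{123}$) $g'_*(g^*\alpha\bullet\beta)=\alpha\bullet g_*\beta$ for a fiber square with $f:X\to Y$, $g:Y'\to Y$, $g':X'\to X$, $f':X'\to Y'$, a morphism $h:Y\to Z$, $\alpha\in\mathbb B(X\xrightarrow{f}Y)$, $\beta\in\mathbb B(Y'\xrightarrow{h\circ g}Z)$; - (Units) there are $1_X\in\mathbb B(X\xrightarrow{\mathrm{id}_X}X)$ with $\alpha\bullet1_X=\alpha$, $1_X\bullet\beta=\beta$ whenever defined, and $g^*1_X=1_{X'}$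 for $g:X'\to X$. A subtheory is a family of subsets closed under the three operations and containing the units. **Co-operational bivariant theory $\mathbb B^{coop}F^*$.** An element $c\in\mathbb B^{coop}F^*(X\xrightarrow{f}Y)$ is a collection of maps $c_g:F^*(X')\to F^*(Y')$, one for each $g:Y'\to Y$ and the fiber square with $X'=X\times_YY'$, $f':X'\to Y'$, $g':X'\to X$. These are required to be compatible with pullback: for a further $h:Y''\to Y'$ with fiber square $h':X''\to X'$, $f'':X''\to Y''$, one has $c_{g\circ h}\circ h'^*=h^*\circ c_g$. (Fiber products are identified via canonical isomorphisms.) Operations: for $X\xrightarrow{f}Y\xrightarrow{g}Z$, $h:Z'\to Z$, with stacked fiber squares $X'\xrightarrow{f'}Y'\xrightarrow{g'}Z'$ over $h'':X'\to X$, $h':Y'\to Y$, $h$: - $(c\bullet d)_h:=d_h\circ c_{h'}$; - $(f_*c)_h:=c_h\circ f'^*$; - $(g^*c)_h:=c_{g\circ h}$ for the pullback along $g:Y'\to Y$ and $h:Y''\to Y'$. It is known that $\mathbb B^{coop}F^*$ is a bivariant theory. **Derived theory $\delta\mathbb B^{coop}F^*$.** A morphism $f:X\to Y$ is sectional if it has a section $s:Y\to X$, $f\circ s=\mathrm{id}_Y$. For $g:Y'\to Y$, the pullback $f':X'\to Y'$ has the induced section $s':Y'\to X'$, determined by $f'\circ s'=\mathrm{id}_{Y'}$ and $g'\circ s'=s\circ g$. - If $f$ is sectional, $\delta\mathbb B^{coop}F^*(X\xrightarrow{f}Y)$ is the set of all families $\{s'^*\circ\theta_{X'}:F^*(X')\to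 F^*(Y')\mid g:Y'\to Y\}$ with $\theta\in coopF^*$ and $s$ a section of $f$. - If $f$ is not sectional, $\delta\mathbb B^{coop}F^*(X\xrightarrow{f}Y)=\mathbf 0$, the set consisting of the single family of zero maps $F^*(X')\to F^*(Y')$ (constant with value $0$). *)

(* Defs.v *)
From Stdlib Require Import ClassicalEpsilon FunctionalExtensionality ProofIrrelevance.
Export EqNotations.

Set Implicit Arguments.
Unset Strict Implicit.
Unset Printing Implicit Defensive.

Record category := Category {
  obj :> Type;
  hom : obj -> obj -> Type;
  idm : forall X, hom X X;
  comp : forall X Y Z, hom Y Z -> hom X Y -> hom X Z;
  comp_assoc : forall X Y Z W (h : hom Z W) (g : hom Y Z) (f : hom X Y),
    comp h (comp g f) = comp (comp h g) f;
  comp_idl : forall X Y (f : hom X Y), comp (idm Y) f = f;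
  comp_idr : forall X Y (f : hom X Y), comp f (idm X) = f
}.

Arguments idm {c} X.
Arguments comp_assoc {c X Y Z W} h g f.
Arguments comp_idl {c X Y} f.
Arguments comp_idr {c X Y} f.
Notation "g '\oc' f" := (comp g f) (at level 40, left associativity).

(* The square
        X' --g'--> X
        |f'        |f
        Y' --g---> Y
   commutes and is cartesian. *)
Definition fiber_square (C : category) (X Y X' Y' : C)
    (f : hom X Y) (f' : hom X' Y') (g : hom Y' Y) (g' : hom X' X) : Prop :=
  f \oc g' = g \oc f' /\
  forall (T : C) (a : hom T X) (b : hom T Y'), f \oc a = g \oc b ->
    exists! u : hom T X', g' \oc u = a /\ f' \oc u = b.

Definition has_final_object (C : category) : Prop :=
  exists T : C, forall X : C, exists! u : hom X T, True.

Definition has_fiber_products (C : category) : Prop :=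
  forall (X Y Y' : C) (f : hom X Y) (g : hom Y' Y),
  exists (X' : C) (f' : hom X' Y') (g' : hom X' X), fiber_square f f' g g'.

Section FiberSquares.
Variable C : category.
Implicit Types X Y Z T : C.

Lemma induced_ex X Y X' Y' (f : hom X Y) (f' : hom X' Y') (g : hom Y' Y)
    (g' : hom X' X) (S : fiber_square f f' g g')
    T (a : hom T X) (b : hom T Y') (e : f \oc a = g \oc b) :
  exists u : hom T X', g' \oc u = a /\ f' \oc u = b.
Proof. destruct (proj2 S T a b e) as [u [Hu _]]; exists u; exact Hu. Qed.

Definition induced X Y X' Y' (f : hom X Y) (f' : hom X' Y') (g : hom Y' Y)
    (g' : hom X' X) (S : fiber_square f f' g g')
    T (a : hom T X) (b : hom T Y') (e : f \oc a = g \oc b) : hom T X' :=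
  proj1_sig (constructive_indefinite_description _ (induced_ex S e)).

Section InducedTheory.
Variables (X Y X' Y' : C) (f : hom X Y) (f' : hom X' Y') (g : hom Y' Y).
Variables (g' : hom X' X) (S : fiber_square f f' g g').

Lemma induced1 T (a : hom T X) (b : hom T Y') (e : f \oc a = g \oc b) :
  g' \oc induced S e = a.
Proof. unfold induced; destruct constructive_indefinite_description as [u [H1 H2]]; exact H1. Qed.

Lemma induced2 T (a : hom T X) (b : hom T Y') (e : f \oc a = g \oc b) :
  f' \oc induced S e = b.
Proof. unfold induced; destruct constructive_indefinite_description as [u [H1 H2]]; exact H2. Qed.

Lemma fiber_square_mono T (u v : hom T X') :
  g' \oc u = g' \oc v -> f' \oc u = f' \oc v -> u = v.
Proof.
intros Ha Hb.
assert (e : f \oc (g' \oc v) = g \oc (f' \oc v)).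
{ rewrite !comp_assoc, (proj1 S); reflexivity. }
destruct (proj2 S T _ _ e) as [w [_ Hw]].
rewrite <- (Hw u (conj Ha Hb)); apply Hw; split; reflexivity.
Qed.
End InducedTheory.

Lemma fiber_square_of_lift X Y X' Y' (f : hom X Y) (f' : hom X' Y')
    (g : hom Y' Y) (g' : hom X' X) :
  f \oc g' = g \oc f' ->
  (forall T (a : hom T X) (b : hom T Y'), f \oc a = g \oc b ->
     exists u : hom T X', g' \oc u = a /\ f' \oc u = b) ->
  (forall T (u v : hom T X'), g' \oc u = g' \oc v -> f' \oc u = f' \oc v -> u = v) ->
  fiber_square f f' g g'.
Proof.
intros e Hex Hmono; split; [exact e|].
intros T a b eab; destruct (Hex T a b eab) as [u [H1 H2]].
exists u; split; [split; assumption|].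
intros v [K1 K2]; apply Hmono; congruence.
Qed.

Lemma fiber_square_id X X' (g : hom X' X) : fiber_square (idm X) (idm X') g g.
Proof.
apply fiber_square_of_lift.
- rewrite comp_idl, comp_idr; reflexivity.
- intros T a b e; exists b; rewrite comp_idl in e; rewrite comp_idl; split; congruence.
- intros T u v _ H; rewrite !comp_idl in H; exact H.
Qed.

Lemma hpaste X Y X' Y' X'' Y'' (f : hom X Y) (f' : hom X' Y') (f'' : hom X'' Y'')
    (g : hom Y' Y) (g' : hom X' X) (h : hom Y'' Y') (h' : hom X'' X') :
  fiber_square f f' g g' -> fiber_square f' f'' h h' ->
  fiber_square f f'' (g \oc h) (g' \oc h').
Proof.
intros S T; apply fiber_square_of_lift.
- rewrite comp_assoc, (proj1 S), <- !comp_assoc, (proj1 T); reflexivity.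
- intros U a b e.
  assert (e1 : f \oc a = g \oc (h \oc b)) by (rewrite comp_assoc; exact e).
  exists (induced T (induced2 S e1)); split.
  + rewrite <- comp_assoc, !induced1; reflexivity.
  + apply induced2.
- intros U u v H1 H2; apply (fiber_square_mono T); [|exact H2].
  apply (fiber_square_mono S).
  + rewrite !comp_assoc; exact H1.
  + rewrite !comp_assoc, (proj1 T), <- !comp_assoc, H2; reflexivity.
Qed.

Lemma vpaste X Y Z X' Y' Z' (f : hom X Y) (g : hom Y Z) (f' : hom X' Y')
    (g' : hom Y' Z') (h : hom Z' Z) (h' : hom Y' Y) (h'' : hom X' X) :
  fiber_square f f' h' h'' -> fiber_square g g' h h' ->
  fiber_square (g \oc f) (g' \oc f') h h''.
Proof.
intros S T; apply fiber_square_of_lift.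
- rewrite <- comp_assoc, (proj1 S), comp_assoc, (proj1 T), comp_assoc; reflexivity.
- intros U a b e.
  assert (e1 : g \oc (f \oc a) = h \oc b) by (rewrite comp_assoc; exact e).
  exists (induced S (eq_sym (induced1 T e1))); split.
  + apply induced1.
  + rewrite <- comp_assoc, !induced2; reflexivity.
- intros U u v H1 H2; apply (fiber_square_mono S); [exact H1|].
  apply (fiber_square_mono T).
  + rewrite !comp_assoc, <- (proj1 S), <- !comp_assoc, H1; reflexivity.
  + rewrite !comp_assoc; exact H2.
Qed.

Lemma upper_eq X Y Z X' Z' (f : hom X Y) (g : hom Y Z) (k : hom X' Z')
    (h : hom Z' Z) (h'' : hom X' X) :
  fiber_square (g \oc f) k h h'' -> g \oc (f \oc h'') = h \oc k.
Proof. intros S; rewrite comp_assoc; exact (proj1 S). Qed.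

Lemma fiber_square_upper X Y Z X' Y' Z' (f : hom X Y) (g : hom Y Z)
    (g' : hom Y' Z') (k : hom X' Z') (h : hom Z' Z) (h' : hom Y' Y) (h'' : hom X' X)
    (S : fiber_square (g \oc f) k h h'') (T : fiber_square g g' h h') :
  fiber_square f (induced T (upper_eq S)) h' h''.
Proof.
apply fiber_square_of_lift.
- rewrite induced1; reflexivity.
- intros U a b e.
  assert (e1 : (g \oc f) \oc a = h \oc (g' \oc b)).
  { rewrite <- comp_assoc, e, !comp_assoc, (proj1 T); reflexivity. }
  exists (induced S e1); split; [apply induced1|].
  apply (fiber_square_mono T).
  + rewrite comp_assoc, induced1, <- comp_assoc, induced1; exact e.
  + rewrite comp_assoc, !induced2; reflexivity.
- intros U u v H1 H2; apply (fiber_square_mono S); [exact H1|].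
  rewrite <- (induced2 T (upper_eq S)), <- !comp_assoc, H2; reflexivity.
Qed.

End FiberSquares.

Record chosen_square (C : category) (X Y Y' : C) (f : hom X Y) (g : hom Y' Y) :=
  ChosenSquare {
  fp_obj : C;
  fp_base : hom fp_obj Y';
  fp_top : hom fp_obj X;
  fp_square : fiber_square f fp_base g fp_top
}.

Lemma chosen_square_ex (C : category) (hP : has_fiber_products C)
    (X Y Y' : C) (f : hom X Y) (g : hom Y' Y) :
  exists _ : chosen_square f g, True.
Proof.
destruct (hP X Y Y' f g) as [X' [f' [g' S]]].
exists (ChosenSquare S); exact I.
Qed.

Definition fp (C : category) (hP : has_fiber_products C)
    (X Y Y' : C) (f : hom X Y) (g : hom Y' Y) : chosen_square f g :=
  proj1_sig (constructive_indefinite_description _ (chosen_square_ex hP f g)).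

Record bivariant_ops (C : category) := BivariantOps {
  bset :> forall X Y : C, hom X Y -> Type;
  bprod : forall X Y Z (f : hom X Y) (g : hom Y Z),
    bset f -> bset g -> bset (g \oc f);
  bpush : forall X Y Z (f : hom X Y) (g : hom Y Z), bset (g \oc f) -> bset g;
  bpull : forall X Y X' Y' (f : hom X Y) (f' : hom X' Y') (g : hom Y' Y)
    (g' : hom X' X), fiber_square f f' g g' -> bset f -> bset f';
  bunit : forall X, bset (idm X)
}.

Arguments bprod {C} _ {X Y Z f g} _ _.
Arguments bpush {C} _ {X Y Z} f g _.
Arguments bpull {C} _ {X Y X' Y' f f' g g'} _ _.
Arguments bunit {C} _ X.

Lemma projection_eq (C : category) (X Y Z X' Y' : C) (f : hom X Y) (f' : hom X' Y')
    (g : hom Y' Y) (g' : hom X' X) (h : hom Y Z) :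
  fiber_square f f' g g' -> (h \oc g) \oc f' = (h \oc f) \oc g'.
Proof. intros S; rewrite <- !comp_assoc, (proj1 S); reflexivity. Qed.

(* Associativity and unitality of composition hold only propositionally, so
   the two sides of an axiom are compared after transport ([rew]) along the
   corresponding equality of morphisms. Every morphism is confined and every
   fiber square is independent, so [bpush] and [bpull] are total. *)
Record is_bivariant_theory (C : category) (B : bivariant_ops C) : Prop := {
  bivA1 : forall X Y Z W (f : hom X Y) (g : hom Y Z) (h : hom Z W)
      (a : B _ _ f) (b : B _ _ g) (c : B _ _ h),
    rew [B X W] (comp_assoc h g f) in bprod B (bprod B a b) c
    = bprod B a (bprod B b c);
  bivA2 : forall X Y Z W (f : hom X Y) (g : hom Y Z) (h : hom Z W)
      (a : B _ _ (h \oc (g \oc f))),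
    bpush B (g \oc f) h a
    = bpush B g h (bpush B f (h \oc g) (rew [B X W] (comp_assoc h g f) in a));
  bivA3 : forall X Y X' Y' X'' Y'' (f : hom X Y) (f' : hom X' Y') (f'' : hom X'' Y'')
      (g : hom Y' Y) (g' : hom X' X) (h : hom Y'' Y') (h' : hom X'' X')
      (S : fiber_square f f' g g') (T : fiber_square f' f'' h h') (a : B _ _ f),
    bpull B (hpaste S T) a = bpull B T (bpull B S a);
  bivA12 : forall X Y Z W (f : hom X Y) (g : hom Y Z) (h : hom Z W)
      (a : B _ _ (g \oc f)) (b : B _ _ h),
    bpush B f (h \oc g) (rew [B X W] (comp_assoc h g f) in bprod B a b)
    = bprod B (bpush B f g a) b;
  bivA13 : forall X Y Z X' Y' Z' (f : hom X Y) (g : hom Y Z)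
      (f' : hom X' Y') (g' : hom Y' Z') (h : hom Z' Z) (h' : hom Y' Y) (h'' : hom X' X)
      (S : fiber_square f f' h' h'') (T : fiber_square g g' h h')
      (a : B _ _ f) (b : B _ _ g),
    bpull B (vpaste S T) (bprod B a b) = bprod B (bpull B S a) (bpull B T b);
  bivA23 : forall X Y Z X' Y' Z' (f : hom X Y) (g : hom Y Z)
      (f' : hom X' Y') (g' : hom Y' Z') (h : hom Z' Z) (h' : hom Y' Y) (h'' : hom X' X)
      (S : fiber_square f f' h' h'') (T : fiber_square g g' h h')
      (a : B _ _ (g \oc f)),
    bpush B f' g' (bpull B (vpaste S T) a) = bpull B T (bpush B f g a);
  bivA123 : forall X Y Z X' Y' (f : hom X Y) (f' : hom X' Y') (g : hom Y' Y)
      (g' : hom X' X) (h : hom Y Z) (S : fiber_square f f' g g')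
      (a : B _ _ f) (b : B _ _ (h \oc g)),
    bpush B g' (h \oc f) (rew [B X' Z] (projection_eq h S) in bprod B (bpull B S a) b)
    = bprod B a (bpush B g h b);
  biv_unitr : forall X Y (f : hom X Y) (a : B _ _ f),
    rew [B X Y] (comp_idl f) in bprod B a (bunit B Y) = a;
  biv_unitl : forall X Y (f : hom X Y) (b : B _ _ f),
    rew [B X Y] (comp_idr f) in bprod B (bunit B X) b = b;
  biv_unit_pull : forall X X' (g : hom X' X),
    bpull B (fiber_square_id g) (bunit B X) = bunit B X'
}.

Record is_subtheory (C : category) (B : bivariant_ops C)
    (P : forall (X Y : C) (f : hom X Y), B X Y f -> Prop) : Prop := {
  sub_prod : forall X Y Z (f : hom X Y) (g : hom Y Z) (a : B _ _ f) (b : B _ _ g),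
    P X Y f a -> P Y Z g b -> P X Z (g \oc f) (bprod B a b);
  sub_push : forall X Y Z (f : hom X Y) (g : hom Y Z) (a : B _ _ (g \oc f)),
    P X Z (g \oc f) a -> P Y Z g (bpush B f g a);
  sub_pull : forall X Y X' Y' (f : hom X Y) (f' : hom X' Y') (g : hom Y' Y)
      (g' : hom X' X) (S : fiber_square f f' g g') (a : B _ _ f),
    P X Y f a -> P X' Y' f' (bpull B S a);
  sub_unit : forall X, P X X (idm X) (bunit B X)
}.

Definition restrict (C : category) (B : bivariant_ops C)
    (P : forall (X Y : C) (f : hom X Y), B X Y f -> Prop)
    (hP : is_subtheory P) : bivariant_ops C := {|
  bset := fun X Y f => {a : B X Y f | P X Y f a};
  bprod := fun X Y Z f g a b =>
    exist _ (bprod B (proj1_sig a) (proj1_sig b))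
      (sub_prod hP (proj2_sig a) (proj2_sig b));
  bpush := fun X Y Z f g a =>
    exist _ (bpush B f g (proj1_sig a)) (sub_push hP (proj2_sig a));
  bpull := fun X Y X' Y' f f' g g' S a =>
    exist _ (bpull B S (proj1_sig a)) (sub_pull hP S (proj2_sig a));
  bunit := fun X => exist _ (bunit B X) (sub_unit hP X)
|}.

(* Only the underlying sets and the zero elements of the values of the functor
   matter: maps between values are not required to preserve more structure. *)
Record pointed_functor (C : category) := PointedFunctor {
  fset :> C -> Type;
  fzero : forall X, fset X;
  fmap : forall X Y, hom X Y -> fset Y -> fset X;
  fmap_id : forall X (x : fset X), fmap (idm X) x = x;
  fmap_comp : forall X Y Z (g : hom Y Z) (f : hom X Y) (x : fset Z),
    fmap (g \oc f) x = fmap f (fmap g x);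
  fmap_zero : forall X Y (f : hom X Y), fmap f (fzero Y) = fzero X
}.

Arguments fzero {C} p X.
Arguments fmap {C} p {X Y} _ _.

Record coop_op (C : category) (F : pointed_functor C) := CoopOp {
  op_map :> forall X, F X -> F X;
  op_natural : forall X Y (f : hom X Y) (y : F Y),
    fmap F f (op_map y) = op_map (fmap F f y);
  op_zero : forall X, op_map (fzero F X) = fzero F X
}.

Arguments op_map {C F} _ X _.

(* A family is indexed by all fiber squares over [g : Y' -> Y], not by chosen
   fiber products. The compatibility condition with [h] an identity makes it
   commute with the canonical isomorphisms between fiber products. *)
Record coop_elt (C : category) (F : pointed_functor C) (X Y : C) (f : hom X Y) :=
  CoopElt {
  coop_map : forall X' Y' (f' : hom X' Y') (g : hom Y' Y) (g' : hom X' X),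
    fiber_square f f' g g' -> F X' -> F Y';
  coop_compat : forall X' Y' X'' Y'' (f' : hom X' Y') (f'' : hom X'' Y'')
      (g : hom Y' Y) (g' : hom X' X) (h : hom Y'' Y') (h' : hom X'' X')
      (S : fiber_square f f' g g') (T : fiber_square f' f'' h h') (x : F X'),
    coop_map (hpaste S T) (fmap F h' x) = fmap F h (coop_map S x)
}.

Arguments coop_map {C F X Y f} _ {X' Y' f' g g'} _ _.

Section Coop.
Variables (C : category) (hP : has_fiber_products C) (F : pointed_functor C).
Implicit Types X Y Z : C.

Lemma coop_compat_eq X Y (f : hom X Y) (c : coop_elt F f)
    X' Y' X'' Y'' (f' : hom X' Y') (f'' : hom X'' Y'')
    (g : hom Y' Y) (g' : hom X' X) (h : hom Y'' Y') (h' : hom X'' X')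
    (k : hom Y'' Y) (k' : hom X'' X)
    (S : fiber_square f f' g g') (R : fiber_square f f'' k k') (x : F X') :
  k = g \oc h -> k' = g' \oc h' -> f' \oc h' = h \oc f'' ->
  coop_map c R (fmap F h' x) = fmap F h (coop_map c S x).
Proof.
intros e e' e''; subst k k'.
assert (T : fiber_square f' f'' h h').
{ apply fiber_square_of_lift.
  - exact e''.
  - intros U a b H.
    assert (e1 : f \oc (g' \oc a) = (g \oc h) \oc b).
    { rewrite comp_assoc, (proj1 S), <- !comp_assoc, H; reflexivity. }
    exists (induced R e1); split; [|apply induced2].
    apply (fiber_square_mono S).
    + rewrite comp_assoc, induced1; reflexivity.
    + rewrite comp_assoc, e'', <- comp_assoc, induced2; symmetry; exact H.
  - intros U u v H1 H2; apply (fiber_square_mono R); [|exact H2].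
    rewrite <- !comp_assoc, H1; reflexivity. }
rewrite (proof_irrelevance _ R (hpaste S T)); apply coop_compat.
Qed.

(* [S] is the outer square over [h]; the stacked squares are obtained from
   the chosen fiber product of [g] along [h]. *)
Definition coop_prod_map X Y Z (f : hom X Y) (g : hom Y Z)
    (c : coop_elt F f) (d : coop_elt F g) X' Z' (k : hom X' Z') (h : hom Z' Z)
    (h'' : hom X' X) (S : fiber_square (g \oc f) k h h'') (x : F X') : F Z' :=
  let T := fp_square (fp hP g h) in
  coop_map d T (coop_map c (fiber_square_upper S T) x).

Lemma coop_prod_compat X Y Z (f : hom X Y) (g : hom Y Z)
    (c : coop_elt F f) (d : coop_elt F g) X' Z' X'' Z''
    (k : hom X' Z') (k' : hom X'' Z'')
    (h : hom Z' Z) (h'' : hom X' X) (i : hom Z'' Z') (i'' : hom X'' X')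
    (S : fiber_square (g \oc f) k h h'') (R : fiber_square k k' i i'') (x : F X') :
  coop_prod_map c d (hpaste S R) (fmap F i'' x)
  = fmap F i (coop_prod_map c d S x).
Proof.
unfold coop_prod_map.
set (T := fp_square (fp hP g h)); set (T' := fp_square (fp hP g (h \oc i))).
assert (e : g \oc fp_top (fp hP g (h \oc i))
            = h \oc (i \oc fp_base (fp hP g (h \oc i)))).
{ rewrite (proj1 T'), comp_assoc; reflexivity. }
set (i' := induced T e).
rewrite (@coop_compat_eq _ _ _ c _ _ _ _ _ _ _ _ i' i'' _ _
           (fiber_square_upper S T) (fiber_square_upper (hpaste S R) T')).
- apply coop_compat_eq; [reflexivity| |].
  + symmetry; apply induced1.
  + apply induced2.
- symmetry; apply induced1.
- reflexivity.
- apply (fiber_square_mono T); rewrite !comp_assoc.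
  + unfold i'; rewrite !induced1, <- comp_assoc; reflexivity.
  + unfold i'; rewrite !induced2, <- comp_assoc, induced2; exact (proj1 R).
Qed.

Definition coop_prod X Y Z (f : hom X Y) (g : hom Y Z)
    (c : coop_elt F f) (d : coop_elt F g) : coop_elt F (g \oc f) :=
  CoopElt (@coop_prod_compat X Y Z f g c d).

Definition coop_push_map X Y Z (f : hom X Y) (g : hom Y Z)
    (c : coop_elt F (g \oc f)) Y' Z' (g' : hom Y' Z') (h : hom Z' Z)
    (h' : hom Y' Y) (T : fiber_square g g' h h') (y : F Y') : F Z' :=
  let S := fp hP f h' in
  coop_map c (vpaste (fp_square S) T) (fmap F (fp_base S) y).

Lemma coop_push_compat X Y Z (f : hom X Y) (g : hom Y Z)
    (c : coop_elt F (g \oc f)) Y' Z' Y'' Z'' (g' : hom Y' Z') (g'' : hom Y'' Z'')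
    (h : hom Z' Z) (h' : hom Y' Y) (i : hom Z'' Z') (i' : hom Y'' Y')
    (T : fiber_square g g' h h') (R : fiber_square g' g'' i i') (y : F Y') :
  coop_push_map c (hpaste T R) (fmap F i' y) = fmap F i (coop_push_map c T y).
Proof.
unfold coop_push_map.
set (S := fp_square (fp hP f h')); set (S' := fp_square (fp hP f (h' \oc i'))).
assert (e : f \oc fp_top (fp hP f (h' \oc i'))
            = h' \oc (i' \oc fp_base (fp hP f (h' \oc i')))).
{ rewrite (proj1 S'), comp_assoc; reflexivity. }
rewrite <- (@coop_compat_eq _ _ _ c _ _ _ _ _ _ _ _ i (induced S e) _ _
              (vpaste S T) (vpaste S' (hpaste T R))).
- rewrite <- !fmap_comp, induced2; reflexivity.
- reflexivity.
- symmetry; apply induced1.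
- rewrite <- comp_assoc, induced2, !comp_assoc, (proj1 R); reflexivity.
Qed.

Definition coop_push X Y Z (f : hom X Y) (g : hom Y Z)
    (c : coop_elt F (g \oc f)) : coop_elt F g :=
  CoopElt (@coop_push_compat X Y Z f g c).

Definition coop_pull_map X Y X' Y' (f : hom X Y) (f' : hom X' Y') (g : hom Y' Y)
    (g' : hom X' X) (S : fiber_square f f' g g') (c : coop_elt F f)
    X'' Y'' (f'' : hom X'' Y'') (h : hom Y'' Y') (h' : hom X'' X')
    (T : fiber_square f' f'' h h') : F X'' -> F Y'' :=
  coop_map c (hpaste S T).

Lemma coop_pull_compat X Y X1 Y1 (f : hom X Y) (f1 : hom X1 Y1) (g : hom Y1 Y)
    (g' : hom X1 X) (S : fiber_square f f1 g g') (c : coop_elt F f)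
    X' Y' X'' Y'' (f' : hom X' Y') (f'' : hom X'' Y'')
    (h : hom Y' Y1) (h' : hom X' X1) (i : hom Y'' Y') (i' : hom X'' X')
    (T : fiber_square f1 f' h h') (R : fiber_square f' f'' i i') (x : F X') :
  coop_pull_map S c (hpaste T R) (fmap F i' x) = fmap F i (coop_pull_map S c T x).
Proof.
apply coop_compat_eq; [apply comp_assoc..|exact (proj1 R)].
Qed.

Definition coop_pull X Y X' Y' (f : hom X Y) (f' : hom X' Y') (g : hom Y' Y)
    (g' : hom X' X) (S : fiber_square f f' g g') (c : coop_elt F f) : coop_elt F f' :=
  CoopElt (@coop_pull_compat X Y X' Y' f f' g g' S c).

Definition sectional X Y (f : hom X Y) : Prop :=
  exists s : hom Y X, f \oc s = idm Y.

Lemma section_eq X Y (f : hom X Y) (s : hom Y X) (hs : f \oc s = idm Y)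
    Y' (g : hom Y' Y) : f \oc (s \oc g) = g \oc idm Y'.
Proof. rewrite comp_assoc, hs, comp_idl, comp_idr; reflexivity. Qed.

(* The section [s'] of [f'] determined by [g' s' = s g] and [f' s' = id]. *)
Definition induced_section X Y (f : hom X Y) (s : hom Y X) (hs : f \oc s = idm Y)
    X' Y' (f' : hom X' Y') (g : hom Y' Y) (g' : hom X' X)
    (S : fiber_square f f' g g') : hom Y' X' :=
  induced S (section_eq hs g).

Definition section_map (theta : coop_op F) X Y (f : hom X Y) (s : hom Y X)
    (hs : f \oc s = idm Y) X' Y' (f' : hom X' Y') (g : hom Y' Y) (g' : hom X' X)
    (S : fiber_square f f' g g') (x : F X') : F Y' :=
  fmap F (induced_section hs S) (theta X' x).

Lemma section_compat (theta : coop_op F) X Y (f : hom X Y) (s : hom Y X)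
    (hs : f \oc s = idm Y) X' Y' X'' Y'' (f' : hom X' Y') (f'' : hom X'' Y'')
    (g : hom Y' Y) (g' : hom X' X) (h : hom Y'' Y') (h' : hom X'' X')
    (S : fiber_square f f' g g') (T : fiber_square f' f'' h h') (x : F X') :
  section_map theta hs (hpaste S T) (fmap F h' x)
  = fmap F h (section_map theta hs S x).
Proof.
unfold section_map, induced_section.
rewrite <- op_natural, <- !fmap_comp; f_equal.
apply (fiber_square_mono S); rewrite !comp_assoc.
- rewrite !induced1, comp_assoc; reflexivity.
- rewrite induced2, comp_idl, (proj1 T), <- comp_assoc, induced2, comp_idr; reflexivity.
Qed.

Definition section_family (theta : coop_op F) X Y (f : hom X Y) (s : hom Y X)
    (hs : f \oc s = idm Y) : coop_elt F f :=
  CoopElt (@section_compat theta X Y f s hs).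

Definition zero_family X Y (f : hom X Y) : coop_elt F f :=
  @CoopElt C F X Y f (fun _ Y' _ _ _ _ _ => fzero F Y')
    (fun _ _ _ _ _ _ _ _ h _ _ _ _ => eq_sym (fmap_zero F h)).

(* A base change [f' : X' -> Y'] of an identity is an isomorphism; modulo the
   identification of [X'] with [Y'] along it, the unit is the identity. *)
Lemma unit_eq X X' (g : hom X' X) : idm X \oc g = g \oc idm X'.
Proof. rewrite comp_idl, comp_idr; reflexivity. Qed.

Definition coop_unit_map X X' Y' (f' : hom X' Y') (g : hom Y' X) (g' : hom X' X)
    (S : fiber_square (idm X) f' g g') (x : F X') : F Y' :=
  fmap F (induced S (unit_eq g)) x.

Lemma coop_unit_compat X X' Y' X'' Y'' (f' : hom X' Y') (f'' : hom X'' Y'')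
    (g : hom Y' X) (g' : hom X' X) (h : hom Y'' Y') (h' : hom X'' X')
    (S : fiber_square (idm X) f' g g') (T : fiber_square f' f'' h h') (x : F X') :
  coop_unit_map (hpaste S T) (fmap F h' x) = fmap F h (coop_unit_map S x).
Proof.
unfold coop_unit_map; rewrite <- !fmap_comp.
replace (induced S (unit_eq g) \oc h)
  with (h' \oc induced (hpaste S T) (unit_eq (g \oc h))); [reflexivity|].
apply (fiber_square_mono S); rewrite !comp_assoc.
- rewrite !induced1; reflexivity.
- rewrite induced2, comp_idl, (proj1 T), <- comp_assoc, induced2, comp_idr; reflexivity.
Qed.

Definition coop_unit X : coop_elt F (idm X) := CoopElt (@coop_unit_compat X).

Definition coop_theory : bivariant_ops C := {|
  bset := fun X Y f => coop_elt F f;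
  bprod := coop_prod;
  bpush := coop_push;
  bpull := coop_pull;
  bunit := coop_unit
|}.

Definition derived_coop X Y (f : hom X Y) (c : coop_theory X Y f) : Prop :=
  (sectional f ->
     exists (theta : coop_op F) (s : hom Y X) (hs : f \oc s = idm Y),
       c = section_family theta hs) /\
  (~ sectional f -> c = zero_family f).

End Coop.

(* Main.v *)
From Stdlib Require Import FunctionalExtensionality ProofIrrelevance Classical.
Require Import Defs.

Set Implicit Arguments.
Unset Strict Implicit.
Unset Printing Implicit Defensive.

(** The theorem splits into two independent facts.

    The co-operational theory is itself bivariant, and the axioms of a bivariant
    theory are equations, so they descend to every subtheory. For the axioms,
    the point is that product and pushforward, defined through one chosen fiber
    product, take the same value on every pair of stacked fiber squares
    ([coop_prodE], [coop_pushE]): compatibility with pullback, applied along the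
    comparison morphism of two fiber products, absorbs the choice. Both sides of
    an axiom are then evaluated on one common diagram, where they are the same
    composite of maps; only the projection formula ([coop_projection]) uses
    compatibility with pullback once more.

    The derived families are closed under the operations. Sections compose: if
    [s] and [t] are sections of [f] and [g], then [s t] is a section of [g f],
    and naturality gives [t'^* w (s'^* th x) = (s' t')^* (w th) x]. A section
    [s] of [g f] yields the section [f s] of [g], and
    [s'^* th (f'^* x) = (f' s')^* th x]. Sections pull back, and the unit is the
    identity operation with the identity section. The delicate point is the
    zero family of a non-sectional morphism, because the result of an operation
    on it may live over a sectional one: [g f] may have a section when [f] has
    none, [g] may have one when [g f] has none, and a base change may acquire
    one. All three operations turn zero families into zero families (for a zero
    first factor of a product because operations fix [0]), and the zero family is
    a derived one even over a sectional morphism, since it comes from the zero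
    operation and any section at all ([derived_zero]). *)

(** * Restriction to a subtheory *)

Lemma proj1_sig_rew (A : Type) (B : A -> Type) (P : forall a, B a -> Prop)
    (x y : A) (e : x = y) (b : {b : B x | P x b}) :
  proj1_sig (rew [fun a => {b : B a | P a b}] e in b)
  = rew [B] e in proj1_sig b.
Proof. destruct e; reflexivity. Qed.

Lemma restrict_bivariant (C : category) (B : bivariant_ops C)
    (P : forall (X Y : C) (f : hom X Y), B X Y f -> Prop) (hsub : is_subtheory P) :
  is_bivariant_theory B -> is_bivariant_theory (restrict hsub).
Proof.
intros H; split; intros; apply eq_sig_hprop;
  try (intros; apply proof_irrelevance); simpl.
- rewrite proj1_sig_rew; apply (bivA1 H).
- rewrite proj1_sig_rew; apply (bivA2 H).
- apply (bivA3 H).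
- rewrite proj1_sig_rew; apply (bivA12 H).
- apply (bivA13 H).
- apply (bivA23 H).
- rewrite proj1_sig_rew; apply (bivA123 H).
- rewrite proj1_sig_rew; apply (biv_unitr H).
- rewrite proj1_sig_rew; apply (biv_unitl H).
- apply (biv_unit_pull H).
Qed.

(** * The co-operational theory is bivariant *)

Section Cooperational.
Variables (C : category) (hP : has_fiber_products C) (F : pointed_functor C).
Implicit Types X Y Z W : C.

Lemma coop_elt_ext X Y (f : hom X Y) (c d : coop_elt F f) :
  (forall X' Y' (f' : hom X' Y') (g : hom Y' Y) (g' : hom X' X)
     (S : fiber_square f f' g g') (x : F X'), coop_map c S x = coop_map d S x) ->
  c = d.
Proof.
destruct c as [c hc], d as [d hd]; simpl; intros H.
assert (e : c = d).
{ repeat (apply functional_extensionality_dep; intro); apply H. }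
subst d; f_equal; apply proof_irrelevance.
Qed.

(** Axioms whose sides live over propositionally equal morphisms are compared
    pointwise by means of this equation: a transported family takes the same
    values, since a fiber square over one morphism is one over the other. *)
Lemma coop_map_rew X Y (f f0 : hom X Y) (e : f = f0) (c : coop_elt F f)
    X' Y' (f' : hom X' Y') (g : hom Y' Y) (g' : hom X' X)
    (S0 : fiber_square f0 f' g g') (S : fiber_square f f' g g') (x : F X') :
  coop_map (rew [fun k => coop_elt F k] e in c) S0 x = coop_map c S x.
Proof.
destruct e; simpl; rewrite (proof_irrelevance _ S0 S); reflexivity.
Qed.

(** The comparison morphism from the given to the chosen fiber product carries
    the value of [c] on one to the value on the other; compatibility of [d]
    along the same morphism cancels it. *)
Lemma coop_prodE X Y Z (f : hom X Y) (g : hom Y Z)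
    (c : coop_elt F f) (d : coop_elt F g) X' Y' Z' (f' : hom X' Y')
    (g' : hom Y' Z') (k : hom X' Z') (h : hom Z' Z) (h' : hom Y' Y)
    (h'' : hom X' X) (R : fiber_square (g \oc f) k h h'')
    (S : fiber_square f f' h' h'') (T : fiber_square g g' h h') (x : F X') :
  k = g' \oc f' ->
  coop_map (coop_prod hP c d) R x = coop_map d T (coop_map c S x).
Proof.
intros ek; simpl; unfold coop_prod_map.
set (T0 := fp_square (fp hP g h)).
(* comparison of the given fiber product with the chosen one *)
set (i := induced T0 (proj1 T)).
assert (Hc : coop_map c S x
             = fmap F i (coop_map c (fiber_square_upper R T0) x)).
{ rewrite <- (fmap_id x) at 1.
  apply coop_compat_eq.
  - symmetry; apply induced1.
  - symmetry; apply comp_idr.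
  - rewrite comp_idr; apply (fiber_square_mono T0); rewrite comp_assoc; unfold i.
    + rewrite !induced1; exact (proj1 S).
    + rewrite !induced2; exact ek. }
rewrite Hc, <- (fmap_id (coop_map d T0 _)).
symmetry; apply coop_compat_eq.
- symmetry; apply comp_idr.
- symmetry; apply induced1.
- rewrite comp_idl; apply induced2.
Qed.

Lemma coop_pushE X Y Z (f : hom X Y) (g : hom Y Z) (c : coop_elt F (g \oc f))
    X' Y' Z' (f' : hom X' Y') (g' : hom Y' Z') (k : hom X' Z')
    (h : hom Z' Z) (h' : hom Y' Y) (h'' : hom X' X)
    (T : fiber_square g g' h h') (S : fiber_square f f' h' h'')
    (R : fiber_square (g \oc f) k h h'') (y : F Y') :
  k = g' \oc f' ->
  coop_map (coop_push hP c) T y = coop_map c R (fmap F f' y).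
Proof.
intros ek; simpl; unfold coop_push_map.
set (S0 := fp_square (fp hP f h')).
set (i := induced S0 (proj1 S)).
rewrite <- (fmap_id (coop_map c (vpaste S0 T) _)).
rewrite <- (@coop_compat_eq _ _ _ _ _ c _ _ _ _ _ _ _ _ (idm Z') i _ _
              (vpaste S0 T) R).
- rewrite <- fmap_comp; unfold i; rewrite induced2; reflexivity.
- symmetry; apply comp_idr.
- symmetry; apply induced1.
- rewrite comp_idl, <- comp_assoc; unfold i; rewrite induced2; symmetry; exact ek.
Qed.

Lemma coop_map_irrel X Y (f : hom X Y) (c : coop_elt F f) X' Y'
    (f' : hom X' Y') (g : hom Y' Y) (g' : hom X' X)
    (S T : fiber_square f f' g g') (x : F X') : coop_map c S x = coop_map c T x.
Proof. rewrite (proof_irrelevance _ S T); reflexivity. Qed.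

Lemma fiber_square_rew X Y (f f0 : hom X Y) X' Y' (f' : hom X' Y')
    (g : hom Y' Y) (g' : hom X' X) :
  f0 = f -> fiber_square f f' g g' -> fiber_square f0 f' g g'.
Proof. intros e; subst f0; exact (fun S => S). Qed.

Lemma coop_prodA X Y Z W (f : hom X Y) (g : hom Y Z) (h : hom Z W)
    (a : coop_elt F f) (b : coop_elt F g) (c : coop_elt F h) :
  rew [fun k => coop_elt F k] (comp_assoc h g f) in
    coop_prod hP (coop_prod hP a b) c
  = coop_prod hP a (coop_prod hP b c).
Proof.
apply coop_elt_ext; intros X' W' k i i3 R x.
set (U := fp_square (fp hP h i)).
set (T := fp_square (fp hP g (fp_top (fp hP h i)))).
set (S := fiber_square_upper R (vpaste T U)).
rewrite (coop_map_rew _ _ _ (fiber_square_rew (comp_assoc h g f) R)).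
rewrite (coop_prodE _ _ R S (vpaste T U)) by (symmetry; apply induced2).
rewrite (coop_prodE _ _ (vpaste T U) T U) by reflexivity.
rewrite (coop_prodE _ _ _ (vpaste S T) U).
- rewrite (coop_prodE _ _ (vpaste S T) S T) by reflexivity; reflexivity.
- rewrite comp_assoc; symmetry; apply induced2.
Qed.

Lemma coop_push_comp X Y Z W (f : hom X Y) (g : hom Y Z) (h : hom Z W)
    (a : coop_elt F (h \oc (g \oc f))) :
  coop_push hP a
  = coop_push hP (coop_push hP
      (rew [fun k => coop_elt F k] (comp_assoc h g f) in a)).
Proof.
apply coop_elt_ext; intros Z' W' h1 i i1 U z.
set (T := fp_square (fp hP g i1)).
set (S := fp_square (fp hP f (fp_top (fp hP g i1)))).
rewrite (coop_pushE _ U (vpaste S T) (vpaste (vpaste S T) U)) by reflexivity.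
rewrite (coop_pushE _ U T (vpaste T U)) by reflexivity.
rewrite (coop_pushE _ (vpaste T U) S (vpaste S (vpaste T U))) by reflexivity.
rewrite <- fmap_comp.
set (S2 := vpaste S (vpaste T U)).
rewrite (coop_map_rew _ _ _ (fiber_square_rew (comp_assoc h g f) S2)).
generalize (fiber_square_rew (comp_assoc h g f) S2).
rewrite <- comp_assoc; intros S3; apply coop_map_irrel.
Qed.

Lemma coop_pull_comp X Y X' Y' X'' Y'' (f : hom X Y) (f' : hom X' Y')
    (f'' : hom X'' Y'') (g : hom Y' Y) (g' : hom X' X) (h : hom Y'' Y')
    (h' : hom X'' X') (S : fiber_square f f' g g') (T : fiber_square f' f'' h h')
    (a : coop_elt F f) :
  coop_pull (hpaste S T) a = coop_pull T (coop_pull S a).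
Proof.
apply coop_elt_ext; intros; simpl; unfold coop_pull_map; simpl.
unfold coop_pull_map.
(* the two pasted squares agree up to associativity of their horizontal edges *)
match goal with |- coop_map a ?P _ = coop_map a ?Q _ =>
  generalize P Q end.
rewrite <- !comp_assoc; intros; apply coop_map_irrel.
Qed.

Lemma coop_push_prod X Y Z W (f : hom X Y) (g : hom Y Z) (h : hom Z W)
    (a : coop_elt F (g \oc f)) (b : coop_elt F h) :
  coop_push hP
    (rew [fun k => coop_elt F k] (comp_assoc h g f) in coop_prod hP a b)
  = coop_prod hP (coop_push hP a) b.
Proof.
apply coop_elt_ext; intros Y' W' k i i2 R y.
set (U := fp_square (fp hP h i)).
set (T := fiber_square_upper R U).
set (S := fp_square (fp hP f i2)).
rewrite (coop_pushE _ R S (vpaste S R)) by reflexivity.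
rewrite (coop_prodE _ _ R T U) by (symmetry; apply induced2).
rewrite (coop_pushE _ T S (vpaste S T)) by reflexivity.
rewrite (coop_map_rew _ _ _ (fiber_square_rew (comp_assoc h g f) (vpaste S R))).
apply coop_prodE.
rewrite comp_assoc, induced2; reflexivity.
Qed.

Lemma coop_pull_prod X Y Z X' Y' Z' (f : hom X Y) (g : hom Y Z)
    (f' : hom X' Y') (g' : hom Y' Z') (h : hom Z' Z) (h' : hom Y' Y)
    (h'' : hom X' X) (S : fiber_square f f' h' h'') (T : fiber_square g g' h h')
    (a : coop_elt F f) (b : coop_elt F g) :
  coop_pull (vpaste S T) (coop_prod hP a b)
  = coop_prod hP (coop_pull S a) (coop_pull T b).
Proof.
apply coop_elt_ext; intros X1 Z1 k i i2 R x.
set (T1 := fp_square (fp hP g' i)).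
set (S1 := fiber_square_upper R T1).
rewrite (coop_prodE _ _ R S1 T1) by (symmetry; apply induced2).
apply (coop_prodE _ _ (hpaste (vpaste S T) R) (hpaste S S1) (hpaste T T1)).
symmetry; apply induced2.
Qed.

Lemma coop_push_pull X Y Z X' Y' Z' (f : hom X Y) (g : hom Y Z)
    (f' : hom X' Y') (g' : hom Y' Z') (h : hom Z' Z) (h' : hom Y' Y)
    (h'' : hom X' X) (S : fiber_square f f' h' h'') (T : fiber_square g g' h h')
    (a : coop_elt F (g \oc f)) :
  coop_push hP (coop_pull (vpaste S T) a) = coop_pull T (coop_push hP a).
Proof.
apply coop_elt_ext; intros Y1 Z1 g1 i i1 T1 y.
set (S1 := fp_square (fp hP f' i1)).
rewrite (coop_pushE _ T1 S1 (vpaste S1 T1)) by reflexivity.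
symmetry; apply (coop_pushE a (hpaste T T1) (hpaste S S1)
                   (hpaste (vpaste S T) (vpaste S1 T1))).
reflexivity.
Qed.

(** By [V], base change of [X'] along [j] is base change of [X'] along [i] as an
    object over [Y]; by [T] and [V'], so is [X2]. *)
Lemma fiber_square_cube X Y X' Y' X1 Y1 X2 Y2 (f : hom X Y) (f' : hom X' Y')
    (g : hom Y' Y) (g' : hom X' X) (f1 : hom X1 Y1) (i : hom Y1 Y)
    (i' : hom X1 X) (g1 : hom Y2 Y1) (j : hom Y2 Y') (g2 : hom X2 X1)
    (j' : hom X2 X') (f2 : hom X2 Y2)
    (T : fiber_square f f1 i i')
    (V : fiber_square g g1 i j) (V' : fiber_square g' g2 i' j') :
  f \oc g' = g \oc f' ->
  j \oc f2 = f' \oc j' -> g1 \oc f2 = f1 \oc g2 -> fiber_square f' f2 j j'.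
Proof.
intros ef ej eg; apply fiber_square_of_lift.
- symmetry; exact ej.
- intros D p q epq.
  assert (e1 : f \oc (g' \oc p) = i \oc (g1 \oc q)).
  { rewrite comp_assoc, ef, <- comp_assoc, epq, comp_assoc, (proj1 V).
    symmetry; apply comp_assoc. }
  exists (induced V' (eq_sym (induced1 T e1))); split; [apply induced1|].
  apply (fiber_square_mono V); rewrite comp_assoc.
  + rewrite ej, <- comp_assoc, (induced1 V'); exact epq.
  + rewrite eg, <- comp_assoc, !induced2; reflexivity.
- intros D u v H1 H2; apply (fiber_square_mono V'); [exact H1|].
  apply (fiber_square_mono T).
  + rewrite !comp_assoc, <- (proj1 V'), <- !comp_assoc, H1; reflexivity.
  + rewrite !comp_assoc, <- eg, <- !comp_assoc, H2; reflexivity.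
Qed.

(** Over a base change of [Z], both sides pull a class back along the base
    change of [g], apply [a] and apply [b]; the only discrepancy is the order
    of the pullback and [a], which commute by compatibility. *)
Lemma coop_projection X Y Z X' Y' (f : hom X Y) (f' : hom X' Y') (g : hom Y' Y)
    (g' : hom X' X) (h : hom Y Z) (S : fiber_square f f' g g')
    (a : coop_elt F f) (b : coop_elt F (h \oc g)) :
  coop_push hP (rew [fun k => coop_elt F k] (projection_eq h S) in
                  coop_prod hP (coop_pull S a) b)
  = coop_prod hP a (coop_push hP b).
Proof.
apply coop_elt_ext; intros X1 Z1 k i i2 R x.
destruct (fp hP h i) as [Y1 h1 i1 U].
pose proof (fiber_square_upper R U) as T.
pose proof (induced2 U (upper_eq R)) as ek.
generalize dependent (induced U (upper_eq R)); intros f1 T ek.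
destruct (fp hP g i1) as [Y2 g1 j1 V], (fp hP g' i2) as [X2 g2 j2 V'].
(* [f2] is the base change of [f'] along [j1]; it closes the cube over [S] *)
assert (e : g \oc (f' \oc j2) = i1 \oc (f1 \oc g2)).
{ rewrite !comp_assoc, <- (proj1 S), <- (proj1 T), <- !comp_assoc.
  f_equal; exact (proj1 V'). }
pose proof (induced1 V e) as ej; pose proof (induced2 V e) as eg.
set (f2 := induced V e) in *.
pose proof (fiber_square_cube T V V' (proj1 S) ej eg) as T'.
rewrite (coop_prodE _ _ R T U) by (symmetry; exact ek).
rewrite (coop_pushE _ U V (vpaste V U)) by reflexivity.
rewrite (coop_pushE _ R V' (vpaste V' R)) by reflexivity.
rewrite (coop_map_rew _ _ _ (fiber_square_rew (projection_eq h S) (vpaste V' R))).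
rewrite (coop_prodE _ _ _ T' (vpaste V U)).
- f_equal; apply (coop_compat_eq a T (hpaste S T')).
  + exact (proj1 V).
  + exact (proj1 V').
  + symmetry; exact eg.
- rewrite <- comp_assoc, eg, comp_assoc, ek; reflexivity.
Qed.

Lemma coop_unitE X X' (g : hom X' X) (x : F X') :
  coop_map (coop_unit F X) (fiber_square_id g) x = x.
Proof.
simpl; unfold coop_unit_map.
rewrite <- (comp_idl (induced (fiber_square_id g) (unit_eq g))), induced2.
apply fmap_id.
Qed.

Lemma coop_unitr X Y (f : hom X Y) (a : coop_elt F f) :
  rew [fun k => coop_elt F k] (comp_idl f) in coop_prod hP a (coop_unit F Y) = a.
Proof.
apply coop_elt_ext; intros X' Y' f' g g' S x.
rewrite (coop_map_rew _ _ _ (fiber_square_rew (comp_idl f) S)).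
rewrite (coop_prodE _ _ _ S (fiber_square_id g)).
- apply coop_unitE.
- symmetry; apply comp_idl.
Qed.

Lemma coop_unitl X Y (f : hom X Y) (a : coop_elt F f) :
  rew [fun k => coop_elt F k] (comp_idr f) in coop_prod hP (coop_unit F X) a = a.
Proof.
apply coop_elt_ext; intros X' Y' f' g g' S x.
rewrite (coop_map_rew _ _ _ (fiber_square_rew (comp_idr f) S)).
rewrite (coop_prodE _ _ _ (fiber_square_id g') S).
- rewrite coop_unitE; reflexivity.
- symmetry; apply comp_idr.
Qed.

Lemma coop_unit_pull X X' (g : hom X' X) :
  coop_pull (fiber_square_id g) (coop_unit F X) = coop_unit F X'.
Proof.
apply coop_elt_ext; intros X1 Y1 f1 i i1 S x; simpl.
unfold coop_pull_map; simpl; unfold coop_unit_map; f_equal.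
apply (fiber_square_mono S).
- pose proof (induced2 (hpaste (fiber_square_id g) S) (unit_eq (g \oc i))) as e2.
  set (u := induced _ _) in *.
  rewrite induced1, <- (comp_idl (i1 \oc u)), comp_assoc, (proj1 S).
  rewrite <- comp_assoc, e2; apply comp_idr.
- rewrite !induced2; reflexivity.
Qed.

Lemma coop_bivariant : is_bivariant_theory (coop_theory hP F).
Proof.
split.
- exact coop_prodA.
- exact coop_push_comp.
- exact coop_pull_comp.
- exact coop_push_prod.
- exact coop_pull_prod.
- exact coop_push_pull.
- exact coop_projection.
- exact coop_unitr.
- exact coop_unitl.
- exact coop_unit_pull.
Qed.

(** * Closure of the derived families *)

Lemma sectional_comp X Y Z (f : hom X Y) (g : hom Y Z) (s : hom Y X)
    (t : hom Z Y) (hs : f \oc s = idm Y) (ht : g \oc t = idm Z) :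
  (g \oc f) \oc (s \oc t) = idm Z.
Proof.
rewrite <- comp_assoc, (comp_assoc f), hs, comp_idl; exact ht.
Qed.

Lemma sectional_of_comp X Y Z (f : hom X Y) (g : hom Y Z) (s : hom Z X)
    (hs : (g \oc f) \oc s = idm Z) : g \oc (f \oc s) = idm Z.
Proof. rewrite comp_assoc; exact hs. Qed.

Definition id_op : coop_op F :=
  CoopOp (op_map := fun X x => x) (fun X Y f y => eq_refl) (fun X => eq_refl).

Definition zero_op : coop_op F :=
  CoopOp (op_map := fun X _ => fzero F X) (fun X Y f _ => fmap_zero F f)
    (fun X => eq_refl).

Lemma comp_op_natural (w th : coop_op F) X Y (f : hom X Y) (y : F Y) :
  fmap F f (w Y (th Y y)) = w X (th X (fmap F f y)).
Proof. rewrite !op_natural; reflexivity. Qed.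

Lemma comp_op_zero (w th : coop_op F) X : w X (th X (fzero F X)) = fzero F X.
Proof. rewrite !op_zero; reflexivity. Qed.

Definition comp_op (w th : coop_op F) : coop_op F :=
  CoopOp (op_map := fun X x => w X (th X x))
    (comp_op_natural w th) (comp_op_zero w th).

(** Inducing sections on a base change commutes with composing them, since a
    morphism into a fiber product is determined by its two components. *)
Lemma induced_section_comp X Y Z (f : hom X Y) (g : hom Y Z)
    (s : hom Y X) (t : hom Z Y) (hs : f \oc s = idm Y) (ht : g \oc t = idm Z)
    X' Y' Z' (f' : hom X' Y') (g' : hom Y' Z') (k : hom X' Z') (h : hom Z' Z)
    (h' : hom Y' Y) (h'' : hom X' X) (S : fiber_square f f' h' h'')
    (T : fiber_square g g' h h') (R : fiber_square (g \oc f) k h h'') :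
  k = g' \oc f' ->
  induced_section hs S \oc induced_section ht T
  = induced_section (sectional_comp hs ht) R.
Proof.
intros ek; unfold induced_section; apply (fiber_square_mono R); rewrite comp_assoc.
- rewrite !induced1, <- comp_assoc, induced1; apply comp_assoc.
- rewrite (induced2 R), ek, <- (comp_assoc g'), (induced2 S), comp_idr.
  apply induced2.
Qed.

Lemma section_family_prod X Y Z (f : hom X Y) (g : hom Y Z) (th w : coop_op F)
    (s : hom Y X) (t : hom Z Y) (hs : f \oc s = idm Y) (ht : g \oc t = idm Z) :
  coop_prod hP (section_family th hs) (section_family w ht)
  = section_family (comp_op w th) (sectional_comp hs ht).
Proof.
apply coop_elt_ext; intros X' Z' k h h'' R x.
set (T := fp_square (fp hP g h)).
rewrite (coop_prodE _ _ R (fiber_square_upper R T) T)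
  by (symmetry; apply induced2).
simpl; unfold section_map; simpl.
rewrite <- op_natural, <- fmap_comp, (induced_section_comp hs ht _ _ R).
- reflexivity.
- symmetry; apply induced2.
Qed.

Lemma section_family_push X Y Z (f : hom X Y) (g : hom Y Z) (th : coop_op F)
    (s : hom Z X) (hs : (g \oc f) \oc s = idm Z) :
  coop_push hP (section_family th hs)
  = section_family th (sectional_of_comp hs).
Proof.
apply coop_elt_ext; intros Y' Z' g' h h' T y.
set (S := fp_square (fp hP f h')).
rewrite (coop_pushE _ T S (vpaste S T)) by reflexivity.
simpl; unfold section_map; rewrite <- op_natural, <- fmap_comp; f_equal.
unfold induced_section; apply (fiber_square_mono T); rewrite comp_assoc.
- rewrite <- (proj1 S), <- comp_assoc, !induced1; apply comp_assoc.
- rewrite !induced2; reflexivity.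
Qed.

Lemma section_family_pull X Y X' Y' (f : hom X Y) (f' : hom X' Y')
    (g : hom Y' Y) (g' : hom X' X) (S : fiber_square f f' g g') (th : coop_op F)
    (s : hom Y X) (hs : f \oc s = idm Y) :
  coop_pull S (section_family th hs)
  = section_family th (induced2 S (section_eq hs g)).
Proof.
apply coop_elt_ext; intros X1 Y1 f1 h h' T x; simpl.
unfold coop_pull_map; simpl; unfold section_map; f_equal.
unfold induced_section; apply (fiber_square_mono T).
- rewrite induced1; apply (fiber_square_mono S); rewrite !comp_assoc.
  + rewrite !induced1; apply comp_assoc.
  + rewrite (induced2 S), (proj1 T), <- comp_assoc, induced2.
    rewrite comp_idl; apply comp_idr.
- transitivity (idm Y1); [|symmetry]; apply induced2.
Qed.

(** Over a sectional morphism the zero operation turns any section into the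
    zero family. *)
Lemma derived_zero X Y (f : hom X Y) : derived_coop (hP := hP) (zero_family F f).
Proof.
split; [|reflexivity].
intros [s hs]; exists zero_op, s, hs.
apply coop_elt_ext; intros; symmetry; apply fmap_zero.
Qed.

Lemma derived_section X Y (f : hom X Y) (th : coop_op F) (s : hom Y X)
    (hs : f \oc s = idm Y) : derived_coop (hP := hP) (section_family th hs).
Proof.
split.
- intros _; exists th, s, hs; reflexivity.
- intros H; destruct H; exists s; exact hs.
Qed.

Lemma derived_cases X Y (f : hom X Y) (c : coop_theory hP F X Y f) :
  derived_coop c ->
  (exists (th : coop_op F) (s : hom Y X) (hs : f \oc s = idm Y),
     c = section_family th hs)
  \/ ~ sectional f /\ c = zero_family F f.
Proof.
intros [H1 H2]; destruct (classic (sectional f)) as [h|h]; [left|right]; auto.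
Qed.

Lemma derived_prod X Y Z (f : hom X Y) (g : hom Y Z)
    (a : coop_theory hP F X Y f) (b : coop_theory hP F Y Z g) :
  derived_coop a -> derived_coop b ->
  derived_coop (hP := hP) (coop_prod hP a b).
Proof.
intros Ha Hb.
destruct (derived_cases Hb) as [(w & t & ht & eb)|[_ eb]]; subst b.
- destruct (derived_cases Ha) as [(th & s & hs & ea)|[_ ea]]; subst a.
  + rewrite section_family_prod; apply derived_section.
  + replace (coop_prod hP (zero_family F f) (section_family w ht))
      with (zero_family F (g \oc f)); [apply derived_zero|].
    apply coop_elt_ext; intros; simpl; unfold coop_prod_map; simpl.
    unfold section_map; rewrite op_zero, fmap_zero; reflexivity.
- replace (coop_prod hP a (zero_family F g)) with (zero_family F (g \oc f));
    [apply derived_zero|].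
  apply coop_elt_ext; reflexivity.
Qed.

Lemma derived_push X Y Z (f : hom X Y) (g : hom Y Z)
    (a : coop_theory hP F X Z (g \oc f)) :
  derived_coop a -> derived_coop (hP := hP) (coop_push hP a).
Proof.
intros Ha; destruct (derived_cases Ha) as [(th & s & hs & ea)|[_ ea]]; subst a.
- rewrite section_family_push; apply derived_section.
- replace (coop_push hP (zero_family F (g \oc f))) with (zero_family F g);
    [apply derived_zero|].
  apply coop_elt_ext; reflexivity.
Qed.

Lemma derived_pull X Y X' Y' (f : hom X Y) (f' : hom X' Y') (g : hom Y' Y)
    (g' : hom X' X) (S : fiber_square f f' g g') (a : coop_theory hP F X Y f) :
  derived_coop a -> derived_coop (hP := hP) (coop_pull S a).
Proof.
intros Ha; destruct (derived_cases Ha) as [(th & s & hs & ea)|[_ ea]]; subst a.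
- rewrite section_family_pull; apply derived_section.
- replace (coop_pull S (zero_family F f)) with (zero_family F f');
    [apply derived_zero|].
  apply coop_elt_ext; reflexivity.
Qed.

Lemma derived_unit X : derived_coop (hP := hP) (coop_unit F X).
Proof.
replace (coop_unit F X) with (section_family id_op (comp_idl (idm X)));
  [apply derived_section|].
apply coop_elt_ext; intros X' Y' f' g g' S x; simpl.
unfold section_map, coop_unit_map; f_equal; apply (fiber_square_mono S).
- unfold induced_section; rewrite !induced1; apply comp_idl.
- unfold induced_section; rewrite !induced2; reflexivity.
Qed.

Lemma derived_subtheory : is_subtheory (@derived_coop C hP F).
Proof.
split.
- exact derived_prod.
- exact derived_push.
- exact derived_pull.
- exact derived_unit.
Qed.

End Cooperational.

Theorem theorem6p3 :
  forall (C : category) (hT : has_final_object C) (hP : has_fiber_products C)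
    (F : pointed_functor C),
  exists hsub : is_subtheory (@derived_coop C hP F),
    is_bivariant_theory (restrict hsub).
Proof.
intros C _ hP F; exists (derived_subtheory hP F).
apply restrict_bivariant, coop_bivariant.
Qed.
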